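(* Let $R$ be a commutative ring with identity $1\neq 0$ and let $G$ be a torsion abelian group. Then the group ring $RG$ is complemented if and only if $R$ is complemented and $o(G)\subseteq \operatorname{reg}(R)$.
   Context: All rings are commutative with identity $1\neq 0$. Abelian groups are written multiplicatively, and $RG$ denotes the group ring of $G$ over $R$. For a ring $S$, $\operatorname{reg}(S)$ denotes the set of regular elements (non-zero-divisors) of $S$. An element $x\in S$ is called complemented (in $S$) if there is a $y\in S$ such that $xy=0$ and $x+y\in\operatorname{reg}(S)$; the ring $S$ is called complemented if every element of $S$ is complemented. $o(G)$ denotes the set of orders of elements of the torsion subgroup $t(G)$ of $G$ (the set of elements of finite order). The containment $o(G)\subseteq\operatorname{reg}(R)$ means that for every $n\in o(G)$ the element $n\cdot 1_R$ is regular in $R$. *)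

(* Defs.v *)
From HB Require Import structures.
From mathcomp Require Import all_boot all_algebra finmap monalg.

Set Implicit Arguments.
Unset Strict Implicit.
Unset Printing Implicit Defensive.

Import GRing.Theory.
Local Open Scope fset_scope.
Local Open Scope ring_scope.

(* The group G is a zmodType, hence written additively: the group law is
   k1 + k2, its identity is 0 and the n-th power of k is k *+ n. *)

(* The library equips {malg R[K]} with a product only when K is a monomType,
   which forces x * y = 1 -> x = y = 1 and so excludes nontrivial groups. The
   product on the same finitely supported functions is therefore redefined. *)
Definition groupring (R : comNzRingType) (G : zmodType) : Type := {malg R[G]}.

HB.instance Definition _ (R : comNzRingType) (G : zmodType) :=
  GRing.Zmodule.copy (groupring R G) {malg R[G]}.

Section GroupRing.
Context (R : comNzRingType) (G : zmodType).
Implicit Types g : {malg R[G]}.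

Definition grone : {malg R[G]} := << 1 *g 0%R >>.

Definition grmul g1 g2 : {malg R[G]} :=
  \sum_(k1 <- msupp g1) \sum_(k2 <- msupp g2)
     << g1@_k1 * g2@_k2 *g (k1 + k2)%R >>.

Lemma grmulw (d1 d2 : {fset G}) g1 g2 :
  msupp g1 `<=` d1 -> msupp g2 `<=` d2 ->
  grmul g1 g2 = \sum_(k1 <- d1) \sum_(k2 <- d2)
                   << g1@_k1 * g2@_k2 *g (k1 + k2)%R >>.
Proof.
move=> le_d1 le_d2; rewrite /grmul (big_fset_incl _ le_d1) /=.
  apply/eq_bigr=> k1 _; apply/big_fset_incl => // k _ /mcoeff_outdom ->.
  by rewrite mulr0 monalgU0.
move=> k _ /mcoeff_outdom g1k.
by rewrite big1 => // k' _; rewrite g1k mul0r monalgU0.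
Qed.

Lemma grmulC : commutative grmul.
Proof.
move=> g1 g2; rewrite /grmul exchange_big /=.
by apply/eq_bigr=> k2 _; apply/eq_bigr=> k1 _; rewrite mulrC addrC.
Qed.

Lemma grmulUU c1 c2 k1 k2 :
  grmul << c1 *g k1 >> << c2 *g k2 >> = << c1 * c2 *g (k1 + k2)%R >>.
Proof. by rewrite (grmulw msuppU_le msuppU_le) !big_seq_fset1 !mcoeffUU. Qed.

Lemma grmulUg c k g :
  grmul << c *g k >> g = \sum_(k' <- msupp g) << c * g@_k' *g (k + k')%R >>.
Proof.
rewrite (grmulw msuppU_le (fsubset_refl _)) big_seq_fset1.
by apply/eq_bigr => k' _; rewrite mcoeffUU.
Qed.

Lemma grmul1g : left_id grone grmul.
Proof.
move=> g; rewrite grmulUg [RHS]monalgE.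
by apply/eq_bigr=> k _; rewrite mul1r add0r.
Qed.

Lemma grmul0g : left_zero 0 grmul.
Proof. by move=> g; rewrite /grmul msupp0 big_seq_fset0. Qed.

Lemma grmulDl : left_distributive grmul +%R.
Proof.
move=> g1 g2 g; have s := fsubset_refl (msupp g).
rewrite [in RHS](grmulw (fsubsetUl _ (msupp g2)) s).
rewrite [in RHS](grmulw (fsubsetUr (msupp g1) _) s) (grmulw (msuppD_le _ _) s).
rewrite -big_split /=; apply/eq_bigr=> k1 _.
rewrite -big_split /=; apply/eq_bigr=> k2 _.
by rewrite mcoeffD mulrDl monalgUD.
Qed.

Lemma grmulA : associative grmul.
Proof.
have Dr g1 : {morph grmul g1 : x y / x + y}.
  by move=> x y; rewrite !(grmulC g1) grmulDl.
have g0 g1 : grmul g1 0 = 0 by rewrite grmulC grmul0g.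
have El g1 g2 : grmul g1 g2 = \sum_(k <- msupp g1) grmul << g1@_k *g k >> g2.
  by apply/eq_bigr=> k _; rewrite grmulUg.
have Er g1 g2 : grmul g1 g2 = \sum_(k <- msupp g2) grmul g1 << g2@_k *g k >>.
  by rewrite grmulC El; apply/eq_bigr=> k _; rewrite grmulC.
move=> g1 g2 g3.
rewrite [RHS](big_morph (grmul^~ _) (fun _ _ => grmulDl _ _ _) (grmul0g _)).
rewrite El; apply/eq_bigr=> k1 _.
rewrite [LHS](big_morph (grmul _) (Dr _) (g0 _)).
rewrite [RHS](big_morph (grmul^~ _) (fun _ _ => grmulDl _ _ _) (grmul0g _)).
apply/eq_bigr=> k2 _.
rewrite [LHS](big_morph (grmul _) (Dr _) (g0 _)).
by rewrite Er; apply/eq_bigr=> k3 _; rewrite !grmulUU mulrA addrA.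
Qed.

Lemma grone_neq0 : grone != 0.
Proof. by rewrite monalgU_eq0 oner_eq0. Qed.

HB.instance Definition _ := GRing.Zmodule_isComNzRing.Build (groupring R G)
  grmulA grmulC grmul1g grmulDl grone_neq0.

Lemma groupringM_coef (g1 g2 : groupring R G) k :
  (g1 * g2)@_k = \sum_(k1 <- msupp g1) g1@_k1 * g2@_(k - k1)%R.
Proof.
rewrite raddf_sum; apply/eq_bigr => k1 _; rewrite raddf_sum /=.
under eq_bigr => k2 _ do
  rewrite mcoeffU addrC [_ == k]eq_sym -subr_eq eq_sym.
have [ks|kNs] := boolP ((k - k1)%R \in msupp g2).
  rewrite (big_fsetD1 _ ks) /= addrC big1_fset ?add0r.
    by rewrite eqxx.
  by move=> k2; rewrite in_fsetD1 => /andP[/negPf-> _].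
rewrite (mcoeff_outdom kNs) mulr0 big1_fset // => k2 k2s _.
by case: eqP => // e; rewrite -e k2s in kNs.
Qed.

End GroupRing.

Section Complemented.
Context (S : comNzRingType).

Definition reg (x : S) : Prop := forall y : S, x * y = 0 -> y = 0.

Definition complemented_elt (x : S) : Prop :=
  exists y : S, x * y = 0 /\ reg (x + y).

Lemma regP (x : S) : reg x <-> GRing.lreg x.
Proof.
by split=> [/mulrI0_lreg//|rx y xy0]; apply: rx; rewrite xy0 mulr0.
Qed.

End Complemented.

Definition complemented (S : comNzRingType) : Prop :=
  forall x : S, complemented_elt x.

Section Torsion.
Context (G : zmodType).

Definition torsion_elt (g : G) : Prop := exists n : nat, (0 < n)%N /\ g *+ n = 0.

Definition torsion_group : Prop := forall g : G, torsion_elt g.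

Definition has_order (g : G) (n : nat) : Prop :=
  [/\ (0 < n)%N, g *+ n = 0 &
      forall m : nat, (0 < m)%N -> g *+ m = 0 -> (n <= m)%N].

Definition torsion_order (n : nat) : Prop :=
  exists g : G, torsion_elt g /\ has_order g n.

End Torsion.

(* Main.v *)
From HB Require Import structures.
Require Import Defs.
From mathcomp Require Import all_boot all_fingroup all_algebra finmap monalg.
From mathcomp Require Import ring.

Set Implicit Arguments.
Unset Strict Implicit.
Unset Printing Implicit Defensive.

Import GRing.Theory.
Local Open Scope ring_scope.

(** The statement follows from three facts.

    Complemented rings are reduced: if x * x = 0 and y is a complement of x,
    then x + y is regular and kills x. So if RG is complemented and g has
    order n, the sum N of the powers of g satisfies N * N = n N; an r in R
    with n r = 0 makes r N square to zero, hence r N = 0 and r = 0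
    ([reduced_order_reg]).

    Passing from RG down to R uses a norm element. Finitely many elements of
    the torsion group G lie in the image of a finite group I under some
    morphism phi, and I may be chosen with #|I| regular in R ([finite_cover]).
    The sum N of the phi b absorbs every phi a, so it turns multiplication by
    an element of RG supported in the image into multiplication by its
    augmentation, and a N = 0 forces a = 0 for a in R. If y is a complement of
    r in RG, this makes the augmentation of y a complement of r in R
    ([complemented_of_groupring]).

    Passing up from R to RG, first RG is reduced ([groupring_reduced]). An
    element x with x * x = 0 acts on R^I, by convolution through phi, as a
    matrix of square zero whose trace is #|I| times the coefficient of x at
    the identity. Over a reduced ring a matrix of square zero has trace zero
    ([mxtrace_sqr0]), so this coefficient vanishes; translating x, all of them
    do. Moreover every element of RG is integral over R, since every group
    element is a root of some 'X^n - 1. An integral element of a reduced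
    extension of a complemented ring is complemented
    ([integral_complemented_elt]): were R a field, write its monic equation as
    x^k q(x) = 0 with q(0) != 0, reduce it to x q(x) = 0, and take q(x) as
    complement; in general a complement of the constant coefficient cuts R
    into a part where that coefficient is regular and a part where it
    vanishes. *)

(** * Reduced and complemented rings *)

Definition reduced (S : comNzRingType) : Prop :=
  forall x : S, x * x = 0 -> x = 0.

Lemma complemented_reduced (S : comNzRingType) : complemented S -> reduced S.
Proof.
move=> cS x xx0; have [y [xy0 regxy]] := cS x.
by apply: regxy; rewrite mulrDl xx0 add0r mulrC.
Qed.

Lemma regM (S : comNzRingType) (x y : S) : reg (x * y) <-> reg x /\ reg y.
Proof.
split=> [rxy | [rx ry] z]; last by rewrite -mulrA => /rx/ry.
split=> z z0; apply: rxy; last by rewrite -mulrA z0 mulr0.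
by rewrite mulrAC z0 mul0r.
Qed.

Section Reduced.
Variables (S : comNzRingType) (redS : reduced S).

Lemma reduced_mul_sqr (x y : S) : x * (x * y) = 0 -> x * y = 0.
Proof. by move=> xxy0; apply: redS; rewrite mulrCA mulrA xxy0 mul0r. Qed.

(** In a reduced ring (x + y) * a = 0 splits into x * a = 0 and y * a = 0 as
    soon as x * y = 0, so regularity of x + y is a statement about the
    annihilator of the pair (x, y). *)
Lemma reduced_reg_add (x y : S) : x * y = 0 ->
  (forall a, x * a = 0 -> y * a = 0 -> a = 0) -> reg (x + y).
Proof.
move=> xy0 H a; rewrite mulrDl => e.
have xa0: x * a = 0.
  apply: reduced_mul_sqr; have := congr1 ( *%R x) e.
  by rewrite mulrDr mulr0 (mulrA x y) xy0 mul0r addr0.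
by apply: H => //; move: e; rewrite xa0 add0r.
Qed.

(** Armendariz's property of reduced rings: vanishing of the low coefficients
    of a product forces all the summands of these coefficients to vanish. With
    the products of smaller total degree already zero, multiplying the
    coefficient of degree i + j by p`_i leaves only p`_i * (p`_i * q`_j). *)
Lemma reduced_coef_mul (p q : {poly S}) m :
  (forall k, (k < m)%N -> (p * q)`_k = 0) ->
  forall i j, (i + j < m)%N -> p`_i * q`_j = 0.
Proof.
move=> pq0 i j; have [k] := ubnP (i + j)%N.
elim: k i j => // k IHk i; have [l] := ubnP i.
elim: l i => // l IHl i; rewrite ltnS => li j; rewrite ltnS => ijk ijm.
have:= pq0 _ ijm; rewrite coefM.
have ile : (i < (i + j).+1)%N by rewrite ltnS leq_addr.
rewrite (bigD1 (Ordinal ile)) //= addKn => e.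
apply: reduced_mul_sqr.
have := congr1 ( *%R p`_i) e; rewrite mulr0 mulrDr mulr_sumr big1 ?addr0 //.
move=> t ne_t; have [ti|it|ti] := ltngtP t i; last first.
- by case/eqP: ne_t; apply: val_inj.
- have tl := ltn_ord t.
  rewrite mulrCA [p`_i * _]IHk ?mulr0 //.
    by apply: leq_trans ijk; rewrite ltn_add2l ltn_subLR // ltn_add2r.
  apply: leq_ltn_trans ijm; rewrite leq_add2l leq_subLR.
  exact: leq_add (ltnW it) _.
- have tl := ltn_ord t; rewrite IHl ?mulr0 ?subnKC //; exact: leq_trans ti li.
Qed.

(** Since A squares to zero, the characteristic polynomials of A and - A have
    product 'X^(2n). Both being monic of degree n, the coefficient of degree n
    - 1 of the first, which is the opposite of the trace, times the leading
    coefficient 1 of the second contributes to the vanishing coefficient of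
    degree 2n - 1. *)
Lemma mxtrace_sqr0 n (A : 'M[S]_n) : A *m A = 0 -> \tr A = 0.
Proof.
case: n A => [|n] A A2; first by rewrite /mxtrace big_ord0.
have pA2 : map_mx polyC A *m map_mx polyC A = 0 by rewrite -map_mxM A2 map_mx0.
have e : char_poly A * char_poly (- A) = 'X^(n.+1 + n.+1).
  rewrite /char_poly -det_mulmx /char_poly_mx map_mxN opprK.
  rewrite mulmxDr !mulmxBl pA2 subr0 [map_mx _ _ *m _]scalar_mxC addrNK.
  by rewrite -scalar_mxM det_scalar -expr2 -exprM mul2n addnn.
have monA : (char_poly (- A))`_n.+1 = 1.
  by have /monicP := char_poly_monic (- A); rewrite lead_coefE size_char_poly.
apply/oppr_inj; rewrite oppr0 -char_poly_trace // -[LHS]mulr1 -monA.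
apply: (@reduced_coef_mul _ _ (n.+1 + n.+1)) => [k lt|]; last by rewrite ltn_add2r.
by rewrite e coefXn ltn_eqF.
Qed.
End Reduced.

(** * Integral elements over a complemented ring *)

(** Induction on the degree of the equation, relative to a scalar u which
    confines the argument to a part of R. Write p = q * 'X + c%:P and let c'
    be a complement of c. Where c' lives, x times the equation reads x^2 q(x)
    = 0, so x q(x) = 0 and q has smaller degree: the induction hypothesis
    gives y'. Where c lives, p(x) itself is a complement, because p(x) a = c a
    whenever x a = 0. The sum c' y' + c p(x) glues the two. *)
Lemma integral_complement_over (R S : comNzRingType) (f : {rmorphism R -> S})
    (cR : complemented R) (redS : reduced S)
    (f_reg : forall c, reg c -> reg (f c)) (x : S) n (p : {poly R}) (u : R) :
    size p = n.+1 -> p \is monic -> f u * x * (map_poly f p).[x] = 0 ->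
  exists y, f u * x * y = 0 /\
    forall a, f u * x * a = 0 -> f u * y * a = 0 -> f u * a = 0.
Proof.
elim: n p u => [|n IHn] p u szp monp.
  have -> : p = 1.
    have /monicP := monp; rewrite lead_coefE szp => p0.
    by rewrite (size1_polyC (eq_leq szp)) p0.
  rewrite rmorph1 hornerC mulr1 => ux0.
  by exists 1; split=> [|a _]; rewrite mulr1.
have [q [c defp]] : exists q c, p = q * 'X + c%:P.
  exists (\poly_(i < size p) p`_i.+1), p`_0; apply/polyP => -[|i].
    by rewrite coefD coefMX coefC add0r.
  rewrite coefD coefMX coefC addr0 /= coef_poly; case: ltnP => // le_p.
  by rewrite nth_default // ltnW.
have qn0 : q != 0.
  apply: contra_eq_neq szp => q0; rewrite defp q0 mul0r add0r size_polyC.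
  by case: (c != 0).
have szq : size q = n.+1.
  by move: szp; rewrite defp size_MXaddC (negPf qn0) => -[].
have monq : q \is monic.
  move: monp; rewrite defp !monicE lead_coefDl ?lead_coefMX //.
  by rewrite size_polyC size_mulX // szq; case: (c != 0).
rewrite defp rmorphD rmorphM /= map_polyX map_polyC /=.
rewrite hornerD hornerMX hornerC => e.
have [c' [cc'0 reg_cc']] := cR c.
have fcc' : f c * f c' = 0 by rewrite -rmorphM cc'0 rmorph0.
set qx := (map_poly f q).[x] in e *.
have e' : f (u * c') * x * qx = 0.
  have e2 : x * (x * (f u * f c' * qx)) = 0.
    transitivity (f c' * (f u * x * (qx * x + f c)) - f c * f c' * (f u * x)).
      by ring.
    by rewrite e fcc' mulr0 mul0r subr0.
  by rewrite -(reduced_mul_sqr redS e2) rmorphM; ring.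
have [y' [xy'0 ann']] := IHn q (u * c') szq monq e'.
set px := qx * x + f c in e *.
exists (f c' * y' + f c * px); split=> [|a xa0 ya0].
  transitivity (f (u * c') * x * y' + f c * (f u * x * px)).
    by rewrite rmorphM; ring.
  by rewrite xy'0 e mulr0 addr0.
have ua' : f (u * c') * a = 0.
  apply: ann'; first by rewrite rmorphM -[RHS](mulr0 (f c')) -xa0; ring.
  have e2 : f c' * (f c' * (f u * y' * a)) = 0.
    transitivity (f c' * (f u * (f c' * y' + f c * px) * a)
                  - f c * f c' * (f u * px * a)); first by ring.
    by rewrite ya0 fcc' mulr0 mul0r subr0.
  by rewrite -(reduced_mul_sqr redS e2) rmorphM; ring.
have uca : f c * (f u * a) = 0.
  apply: reduced_mul_sqr => //.
  transitivity (f u * (f c' * y' + f c * px) * a - f (u * c') * a * y'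
                - f c * qx * (f u * x * a)); first by rewrite /px rmorphM; ring.
  by rewrite ya0 ua' xa0 mulr0 mul0r !subr0.
apply: (f_reg _ reg_cc'); rewrite rmorphD mulrDl uca add0r -[RHS]ua' rmorphM.
ring.
Qed.

Lemma integral_complemented_elt (R S : comNzRingType) (f : {rmorphism R -> S})
    (cR : complemented R) (redS : reduced S)
    (f_reg : forall c, reg c -> reg (f c)) (x : S) :
  integralOver f x -> complemented_elt x.
Proof.
case=> p monp /rootP px0.
have szp : size p = (size p).-1.+1.
  by rewrite prednK // size_poly_gt0 monic_neq0.
have [|y [xy0 ann]] :=
  integral_complement_over cR redS f_reg (x := x) (u := 1) szp monp.
  by rewrite px0 mulr0.
rewrite rmorph1 !mul1r in xy0 ann.
exists y; split=> //; apply: reduced_reg_add => // a xa0 ya0.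
by rewrite -[a]mul1r; apply: ann; rewrite ?mul1r.
Qed.

(** * Group rings *)

Section GroupRing.
Variables (R : comNzRingType) (G : zmodType).
Implicit Types (c d : R) (k l : G) (x y : groupring R G).

Definition grterm c k : groupring R G := << c *g k >>.

Lemma grtermM c d k l : grterm c k * grterm d l = grterm (c * d) (k + l).
Proof. exact: grmulUU. Qed.

Lemma grterm1 : grterm 1 0 = 1. Proof. by []. Qed.

Lemma grterm_sum x : x = \sum_(k <- msupp x) grterm x@_k k.
Proof. exact: monalgE. Qed.

Lemma coef_grtermM c l x k : (grterm c l * x)@_k = c * x@_(k - l).
Proof.
rewrite groupringM_coef msuppU; have [->|_] := eqVneq c 0.
  by rewrite big_seq_fset0 mul0r.
by rewrite big_seq_fset1 mcoeffUU.
Qed.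

Definition grconst c : groupring R G := grterm c 0.

Fact grconst_is_zmod_morphism : zmod_morphism grconst.
Proof. exact: monalgUB. Qed.

Fact grconst_is_monoid_morphism : monoid_morphism grconst.
Proof. by split=> // c d; rewrite grtermM addr0. Qed.

HB.instance Definition _ := GRing.isZmodMorphism.Build R (groupring R G) grconst
  grconst_is_zmod_morphism.
HB.instance Definition _ := GRing.isMonoidMorphism.Build R (groupring R G) grconst
  grconst_is_monoid_morphism.

Lemma coef_grconstM c x k : (grconst c * x)@_k = c * x@_k.
Proof. by rewrite coef_grtermM subr0. Qed.

Lemma grconst_reg c : reg c -> reg (grconst c).
Proof.
move=> rc x cx0; apply/malgP => k; rewrite mcoeff0; apply: rc.
by rewrite -coef_grconstM cx0 mcoeff0.
Qed.

(** ** Finite groups mapping to G *)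

(** The image of phi is a finite subgroup of G. Indexing by I rather than by
    this image makes the relevant cardinal #|I|, which can be made a product
    of orders of elements, hence regular; the price is the multiplicity
    orbit_sum@_0 of the fibres over the image, the size of the kernel. *)
Section Cover.
Variables (I : finZmodType) (phi : {additive I -> G}).

Definition orbit_sum : groupring R G := \sum_b grterm 1 (phi b).

Lemma coef_orbit_sum k : orbit_sum@_k = \sum_b (phi b == k)%:R.
Proof. by rewrite raddf_sum; apply: eq_bigr => b _; apply: mcoeffU. Qed.

Lemma orbit_sumE a : orbit_sum@_(phi a) = orbit_sum@_0.
Proof.
rewrite !coef_orbit_sum (reindex_inj (addIr a)); apply: eq_bigr => b _.
by rewrite raddfD -subr_eq0 addrK.
Qed.

Lemma grterm_orbit_sum c a :
  grterm c (phi a) * orbit_sum = grconst c * orbit_sum.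
Proof.
rewrite !mulr_sumr [RHS](reindex_inj (addrI a)); apply: eq_bigr => b _.
by rewrite !grtermM raddfD add0r.
Qed.

(** The coefficient at 0 counts the kernel of phi, so this is Lagrange's
    theorem. *)
Lemma orbit_sum_coef0 : exists m, #|I|%:R = orbit_sum@_0 * m%:R :> R.
Proof.
have gK : group_set [set b | phi b == 0].
  apply/group_setP; split=> [|a b]; first by rewrite inE raddf0.
  by rewrite !inE raddfD => /eqP-> /eqP->; rewrite addr0.
have /dvdnP[m e] := cardSg (subsetT (group gK)); rewrite cardsT in e.
exists m; rewrite e mulnC natrM coef_orbit_sum; congr (_ * _).
by rewrite -sum1dep_card natr_sum big_mkcond; apply: eq_bigr => b _; case: eqP.
Qed.

Lemma grconst_orbit_sum_eq0 c :
  reg (#|I|%:R : R) -> grconst c * orbit_sum = 0 -> c = 0.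
Proof.
move=> regI cN0; apply: regI; have [m ->] := orbit_sum_coef0.
by rewrite mulrC mulrA -coef_grconstM cN0 mcoeff0 mul0r.
Qed.

(** The matrix on R^I of convolution with the function b |-> x@_(phi b); when
    phi is the inclusion of a finite subgroup, this is multiplication by x. *)
Definition regular_mx x : 'M[R]_#|I| :=
  \matrix_(i, j) x@_(phi (enum_val j) - phi (enum_val i)).

(** Each k in the support of x is hit once by every element of its fibre, and
    the fibres over the image of phi all have the size of the kernel. *)
Lemma regular_mxM x y :
    (forall k, k \in msupp x -> exists b, phi b = k) ->
  regular_mx x *m regular_mx y = orbit_sum@_0 *: regular_mx (x * y).
Proof.
move=> cov; apply/matrixP => i j; rewrite !mxE.
under eq_bigr do rewrite !mxE.
set a := enum_val i; set d := enum_val j.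
rewrite -(big_enum_val (fun b => x@_(phi b - phi a) * y@_(phi d - phi b))).
rewrite (reindex_inj (addrI a)) /= groupringM_coef mulr_sumr.
pose F k := x@_k * y@_(phi d - phi a - k).
transitivity (\sum_b \sum_(k <- msupp x) (phi b == k)%:R * F k).
  apply: eq_bigr => b _; rewrite raddfD addrAC subrr add0r opprD addrA -/(F _).
  have [bx|bNx] := boolP (phi b \in msupp x).
    rewrite (big_fsetD1 _ bx) /= eqxx mul1r big1_fset ?addr0 // => k.
    by rewrite in_fsetD1 eq_sym => /andP[/negPf-> _]; rewrite mul0r.
  rewrite /F (mcoeff_outdom bNx) mul0r big1_fset // => k kx _.
  by case: eqP => [e|_]; [rewrite e kx in bNx | rewrite mul0r].
rewrite exchange_big /= big_seq [RHS]big_seq; apply: eq_bigr => k /cov[b <-].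
by rewrite -mulr_suml -coef_orbit_sum orbit_sumE.
Qed.

Lemma mxtrace_regular_mx x : \tr (regular_mx x) = #|I|%:R * x@_0.
Proof.
rewrite /mxtrace; under eq_bigr do rewrite mxE subrr.
by rewrite sumr_const card_ord mulr_natl.
Qed.

End Cover.

(** ** Torsion groups with regular orders *)

Lemma mulrn_mod (g : G) n m : g *+ n = 0 -> g *+ (m %% n) = g *+ m.
Proof.
by move=> gn; rewrite [in RHS](divn_eq m n) mulrnDr mulnC mulrnA gn mul0rn add0r.
Qed.

Section Torsion.
Hypothesis tG : torsion_group G.
Hypothesis regG : forall n : nat, torsion_order G n -> reg (n%:R : R).

Lemma torsion_has_order (g : G) : exists n, has_order g n.
Proof.
have /ex_minnP[n /andP[n0 /eqP gn] nmin] : exists n, (0 < n)%N && (g *+ n == 0).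
  by have [n [n0 gn]] := tG g; exists n; rewrite n0 gn eqxx.
by exists n; split=> // m m0 gm; apply: nmin; rewrite m0 gm eqxx.
Qed.

Lemma regular_exponent (s : seq G) :
  exists e, (forall g, g \in s -> g *+ e.+1 = 0) /\ reg (e.+1%:R : R).
Proof.
elim: s => [|g s [e [se rege]]]; first by exists 0%N; split=> // z; rewrite mul1r.
have [[|n] gn] := torsion_has_order g; first by case: gn.
have regn : reg (n.+1%:R : R) by apply: regG; exists g.
exists (n.+1 * e.+1).-1; rewrite prednK //; split; last first.
  by rewrite natrM; apply/regM.
move=> h; rewrite inE => /predU1P[->|/se he].
  by case: gn => _ gn _; rewrite mulrnA gn mul0rn.
by rewrite mulnC mulrnA he mul0rn.
Qed.

(** With e.+1 a common exponent of the elements of s, take for I the free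
    module of rank size s over the integers mod e.+1, mapped to G by linear
    combinations. Its cardinal is a power of e.+1. *)
Lemma finite_cover (s : seq G) :
  exists (I : finZmodType) (phi : {additive I -> G}),
    (forall g, g \in s -> exists b, phi b = g) /\ reg (#|I|%:R : R).
Proof.
have [e [se rege]] := regular_exponent s.
pose I : finZmodType := 'rV['I_e.+1]_(size s).
pose phi (v : I) := \sum_i tnth (in_tuple s) i *+ v 0 i.
have phiB : zmod_morphism phi.
  have phiD v w : phi (v + w) = phi v + phi w.
    rewrite -big_split; apply: eq_bigr => i _ /=; rewrite mxE -mulrnDr /=.
    by rewrite mulrn_mod // se ?mem_tnth.
  by move=> v w; apply: (addIr (phi w)); rewrite -phiD !addrNK.
pose phiA : {additive I -> G} :=
  HB.pack phi (GRing.isZmodMorphism.Build _ _ phi phiB).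
exists I, phiA; split=> [g sg|]; last first.
  rewrite card_mx card_ord mul1n natrX.
  elim: (size s) => [|n IHn]; first by move=> z; rewrite mul1r.
  by rewrite exprS; apply/regM.
have lt_i : (index g s < size s)%N by rewrite index_mem.
(* The preimage is the basis vector at the index of g. For e = 0 its entry
   1 %% e.+1 degenerates to 0, but then g = 0. *)
exists (\row_j if j == Ordinal lt_i then inord (1 %% e.+1) else 0).
rewrite /= /phi (bigD1 (Ordinal lt_i)) //= big1 => [|j /negPf ne].
  rewrite mxE eqxx addr0 (tnth_nth 0) /= nth_index // inordK ?ltn_pmod //.
  by rewrite mulrn_mod ?se.
by rewrite mxE ne.
Qed.

(** Translating by - l brings the coefficient at l to 0, where the trace of
    the matrix of the translate reads it off. *)
Lemma groupring_reduced : reduced R -> reduced (groupring R G).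
Proof.
move=> redR x xx0; apply/malgP => l; rewrite mcoeff0.
pose y := grterm 1 (- l) * x.
have yy0 : y * y = 0 by rewrite mulrACA xx0 mulr0.
have <- : y@_0 = x@_l by rewrite coef_grtermM mul1r sub0r opprK.
have [I [phi [cov regI]]] := finite_cover (msupp y).
apply: regI; rewrite -(mxtrace_regular_mx phi); apply: mxtrace_sqr0 => //.
rewrite regular_mxM // yy0; apply/matrixP => i j.
by rewrite !mxE mcoeff0 mulr0.
Qed.

Lemma groupring_integral x : integralOver grconst x.
Proof.
rewrite [x]grterm_sum; elim/big_rec: _ => [|k y _ inty]; first exact: integral0.
apply: integral_add => //.
have -> : grterm x@_k k = grconst x@_k * grterm 1 k.
  by rewrite grtermM mulr1 add0r.
apply: integral_mul; first exact: integral_id.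
have [n [n0 kn]] := tG k.
exists ('X^n - 1); first exact: monic_Xn_sub_1.
rewrite rmorphB rmorph1 rmorphXn /= map_polyX /root !hornerE.
have expk m : grterm 1 k ^+ m = grterm 1 (k *+ m).
  by elim: m => // m IHm; rewrite exprS IHm grtermM mulr1 mulrS.
by rewrite expk kn subrr.
Qed.

Lemma groupring_complemented : complemented R -> complemented (groupring R G).
Proof.
move=> cR x; have redR := complemented_reduced cR.
apply: (integral_complemented_elt cR (groupring_reduced redR) grconst_reg).
exact: groupring_integral.
Qed.

(** The complement of r is the augmentation s of a complement y of r in RG.
    Since y N = s N for the orbit sum N, (r + s) a = 0 gives (r + y) (a N) =
    0, whence a N = 0 and a = 0. *)
Lemma complemented_of_groupring : complemented (groupring R G) -> complemented R.
Proof.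
move=> cRG r; have [y [ry0 reg_ry]] := cRG (grconst r).
have [I [phi [cov regI]]] := finite_cover (msupp y).
pose s := \sum_(k <- msupp y) y@_k.
have yN : y * orbit_sum phi = grconst s * orbit_sum phi.
  rewrite {1}[y]grterm_sum raddf_sum !mulr_suml big_seq [RHS]big_seq.
  by apply: eq_bigr => k /cov[b <-]; rewrite grterm_orbit_sum.
exists s; split.
  by rewrite mulr_sumr big1 // => k _; rewrite -coef_grconstM ry0 mcoeff0.
move=> a rsa0; apply: (grconst_orbit_sum_eq0 (phi := phi) regI); apply: reg_ry.
rewrite mulrCA mulrDl yN -mulrDl -rmorphD mulrA -rmorphM [a * _]mulrC rsa0.
by rewrite rmorph0 mul0r.
Qed.
End Torsion.

(** The sum N of the powers of g satisfies N * N = n N, so n r = 0 forces r N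
    = 0; the powers of g being distinct, r is a coefficient of r N. *)
Lemma reduced_order_reg n :
  reduced (groupring R G) -> torsion_order G n -> reg (n%:R : R).
Proof.
move=> redRG [g [_ [n0 gn gmin]]] r nr0.
pose N : groupring R G := \sum_(i < n) grterm 1 (g *+ i).
have gS i : grterm 1 g * grterm 1 (g *+ i) = grterm 1 (g *+ i.+1).
  by rewrite grtermM mulr1 -mulrS.
have gN i : grterm 1 (g *+ i) * N = N.
  elim: i => [|i IHi]; first by rewrite mulr0n grterm1 mul1r.
  rewrite -gS -mulrA IHi mulr_sumr; under eq_bigr do rewrite gS.
  rewrite /N; case: n n0 gn {gmin nr0 IHi N} => // m _ gm.
  by rewrite big_ord_recr [RHS]big_ord_recl /= gm addrC.
have rN0 : grconst r * N = 0.
  apply: redRG; rewrite mulrACA [N * N]mulr_suml.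
  rewrite (eq_bigr (fun _ => N)) // sumr_const card_ord -mulr_natl.
  rewrite -rmorphM -(rmorph_nat grconst) mulrA -rmorphM /= -mulrA.
  by rewrite [r * n%:R]mulrC nr0 mulr0 rmorph0 mul0r.
have := congr1 (mcoeff 0) rN0.
rewrite coef_grconstM mcoeff0 /N raddf_sum (bigD1 (Ordinal n0)) //= mcoeffUU.
rewrite big1 ?addr0 ?mulr1 // => i ne_i; rewrite mcoeffU; case: eqP => // gi0.
have i0 : (0 < i)%N.
  by rewrite lt0n; apply: contraNneq ne_i => i0; apply/eqP/val_inj.
by have := gmin _ i0 gi0; rewrite leqNgt ltn_ord.
Qed.
End GroupRing.

Theorem theorem2p2 (R : comNzRingType) (G : zmodType) (tG : torsion_group G) :
  complemented (groupring R G) <->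
  complemented R /\ (forall n : nat, torsion_order G n -> reg (n%:R : R)).
Proof.
split=> [cRG | [cR regG]]; last exact: groupring_complemented.
have regG n : torsion_order G n -> reg (n%:R : R).
  by apply: reduced_order_reg; apply: complemented_reduced.
by split=> //; apply: complemented_of_groupring.
Qed.
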